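(* Let $K$ be a field and let $a\ge1$ be an integer. The ideal $J=(x^{2a+1},\,y^{2a+1})$ is a minimal reduction ideal of $$I=(x^{2a+1},\,x^{a+1}y^a,\,x^ay^{a+1},\,y^{2a+1})\subset K[x,y],$$ and the reduction number $r_J(I)$ of $I$ with respect to $J$ is equal to $a$.
   Context: An ideal $J\subseteq I$ is a reduction ideal of $I$ if $I^{r+1}=JI^r$ for some integer $r\ge0$; it is a minimal reduction if it is minimal with respect to inclusion among the reductions of $I$. The reduction number $r_J(I)$ is the smallest integer $r\ge0$ with $I^{r+1}=JI^r$. *)

(* Defs.v *)
From HB Require Import structures.
From mathcomp Require Import all_boot all_order all_algebra.
From mathcomp Require Import mpoly.

Set Implicit Arguments.
Unset Strict Implicit.
Unset Printing Implicit Defensive.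

Import GRing.Theory.
Local Open Scope ring_scope.

Section Ideals.

Variable R : comNzRingType.
Implicit Types (S I J L : R -> Prop).

(* Ideals are Prop-valued predicates, since the ideals quantified over in
   is_minimal_reduction need not have decidable membership; they are compared
   extensionally. *)
Definition is_ideal I : Prop :=
  [/\ I 0,
      forall p q, I p -> I q -> I (p + q)
    & forall c p, I p -> I (c * p)].

Definition ideal_le I J : Prop := forall p, I p -> J p.

Definition ideal_eq I J : Prop := forall p, I p <-> J p.

Definition ideal_span S : R -> Prop := fun p =>
  exists (n : nat) (c s : 'I_n -> R),
    (forall i, S (s i)) /\ p = \sum_(i < n) c i * s i.

Definition ideal_gen (s : seq R) : R -> Prop := ideal_span (fun p => p \in s).

Definition ideal_mul I J : R -> Prop :=
  ideal_span (fun p => exists u v, [/\ I u, J v & p = u * v]).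

Fixpoint ideal_exp I (n : nat) : R -> Prop :=
  if n is m.+1 then ideal_mul I (ideal_exp I m) else fun=> True.

Definition reduction_eq J I (r : nat) : Prop :=
  ideal_eq (ideal_exp I r.+1) (ideal_mul J (ideal_exp I r)).

Definition is_reduction J I : Prop :=
  [/\ is_ideal J, ideal_le J I & exists r, reduction_eq J I r].

Definition is_minimal_reduction J I : Prop :=
  is_reduction J I /\
  (forall L, is_reduction L I -> ideal_le L J -> ideal_eq L J).

Definition is_reduction_number J I (r : nat) : Prop :=
  reduction_eq J I r /\ (forall s, reduction_eq J I s -> (r <= s)%N).

End Ideals.

(* Main.v *)
Require Import Defs.
From mathcomp Require Import all_boot all_order all_algebra.
From mathcomp Require Import mpoly.
From mathcomp Require Import zify ring.

Import GRing.Theory.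
Local Open Scope ring_scope.

(** Write A = x^d, B = x^(a+1) y^a, C = x^a y^(a+1), D = y^d with d = 2a+1, so
    that J = (A, D) and I = (A, B, C, D).  The generators satisfy
    BC = AD, B^(a+1) = A C^a and C^(a+1) = B^a D.

    Upper bound: I^(a+1) is spanned by the products of a+1 generators, and the
    three relations exhibit in each of them a factor A or D times a product of
    a generators ([reduction_gen4]).  Hence I^(a+1) = J I^a.

    Lower bound: if s < a, then C^(s+1) is not in J I^s.  The ideal J I^s is
    spanned by products of s+1 generators involving A or D, and comparing
    exponents shows that no such product divides C^(s+1).  The polynomials
    none of whose monomials divides C^(s+1) form an ideal which separates the
    two ([pure_power_notin]).

    Minimality: the argument is uniform in the ideals I with J <= I <= m^d,
    where m = (x, y).  Let L <= J with I^(r+1) = L I^r.  An element of L has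
    the form al x^d + be y^d, and its part of degree d is given by the
    constants al(0) and be(0).  If these pairs all satisfied a linear relation
    t al(0) + s be(0) = 0 with (s, t) nonzero, then the functional
    [diag], which substitutes t for x^d and s for y^d in the part of lowest
    degree, would vanish on L I^r ([diagM]); but it takes the values t^(r+1)
    and s^(r+1) at x^(d(r+1)) and y^(d(r+1)), which lie in I^(r+1).  So the
    pairs span K^2, that is, J <= L + m J ([gens_mod_maximal]).  As L need not
    be homogeneous and K[x, y] is not local, the conclusion of Nakayama's
    lemma is reached by iteration: J <= L + m^k J for all k, and m^k lies in
    I^(r+1), hence in L, for k large ([power_ideal_le_reduction]). *)

(** * Ideals of a commutative ring *)

Section IdealTheory.

Set Implicit Arguments.
Unset Strict Implicit.

Variable R : comNzRingType.
Implicit Types (S T I J L H : R -> Prop).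

Lemma ideal_sum H n (F : 'I_n -> R) :
  is_ideal H -> (forall i, H (F i)) -> H (\sum_(i < n) F i).
Proof. by case=> H0 HD _ HF; elim/big_ind: _ => // i _; apply: HF. Qed.

Lemma span_ideal S : is_ideal (ideal_span S).
Proof.
split.
- by exists 0%N, (fun=> 0), (fun=> 0); split=> [[]//|]; rewrite big_ord0.
- move=> _ _ [m [c [s [Ss ->]]]] [n [c' [s' [Ss' ->]]]].
  pose glue (f : 'I_m -> R) (f' : 'I_n -> R) i :=
    match split i with inl j => f j | inr j => f' j end.
  exists (m + n)%N, (glue c c'), (glue s s'); split=> [i|].
    by rewrite /glue; case: split.
  rewrite big_split_ord /=; congr (_ + _); apply: eq_bigr => i _.
    by rewrite /glue (unsplitK (inl i)).
  by rewrite /glue (unsplitK (inr i)).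
- move=> b _ [n [c [s [Ss ->]]]]; exists n, (fun i => b * c i), s; split=> //.
  by rewrite mulr_sumr; apply: eq_bigr => i _; rewrite mulrA.
Qed.

Lemma mem_span S p : S p -> ideal_span S p.
Proof.
by move=> Sp; exists 1%N, (fun=> 1), (fun=> p); rewrite big_ord1 mul1r.
Qed.

Lemma span_le S H : is_ideal H -> ideal_le S H -> ideal_le (ideal_span S) H.
Proof.
move=> idH SH _ [n [c [s [Ss ->]]]]; apply: ideal_sum => // i.
by case: idH => _ _; apply; apply: SH.
Qed.

Lemma mul_ideal I J : is_ideal (ideal_mul I J).
Proof. exact: span_ideal. Qed.

Lemma mem_mul I J p q : I p -> J q -> ideal_mul I J (p * q).
Proof. by move=> Ip Jq; apply: mem_span; exists p, q. Qed.

Lemma mul_le I J H : is_ideal H -> (forall p q, I p -> J q -> H (p * q)) ->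
  ideal_le (ideal_mul I J) H.
Proof. by move=> idH IJH; apply: span_le => // _ [p [q [Ip Jq ->]]]; apply: IJH. Qed.

Lemma mul_mono I I' J J' : ideal_le I I' -> ideal_le J J' ->
  ideal_le (ideal_mul I J) (ideal_mul I' J').
Proof.
move=> II' JJ'; apply: mul_le => [|p q /II' Ip /JJ' Jq]; first exact: mul_ideal.
exact: mem_mul.
Qed.

Lemma colon_ideal H q : is_ideal H -> is_ideal (fun p => H (p * q)).
Proof.
case=> H0 HD HM; split=> [|p p'|c p]; rewrite ?mul0r ?mulrDl -?mulrA //.
  exact: HD.
exact: HM.
Qed.

Lemma mul_span_le S T H :
  is_ideal H -> (forall s t, S s -> T t -> H (s * t)) ->
  ideal_le (ideal_mul (ideal_span S) (ideal_span T)) H.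
Proof.
move=> idH STH; apply: mul_le => // p q Sp Tq.
(* Both variables run over ideals: first fix q, then each generator s. *)
apply: (span_le (colon_ideal q idH) _ Sp) => s Ss.
rewrite mulrC; apply: (span_le (colon_ideal s idH) _ Tq) => t Tt.
by rewrite mulrC; apply: STH.
Qed.

Lemma exp_ideal I n : is_ideal (ideal_exp I n).
Proof. by case: n => [|n]; [split | apply: mul_ideal]. Qed.

Lemma mem_exp I p n : I p -> ideal_exp I n (p ^+ n).
Proof. by move=> Ip; elim: n => // n IHn; rewrite exprS; apply: mem_mul. Qed.

Lemma gen_mono (s t : seq R) :
  {subset s <= t} -> ideal_le (ideal_gen s) (ideal_gen t).
Proof.
move=> sub_st; apply: span_le => [|p /sub_st]; first exact: span_ideal.
exact: mem_span.
Qed.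

Lemma gen2P (f g p : R) :
  ideal_gen [:: f; g] p -> exists u v, p = u * f + v * g.
Proof.
move: p; apply: span_le => [|q].
  split.
  - by exists 0, 0; ring.
  - by move=> _ _ [u [v ->]] [u' [v' ->]]; exists (u + u'), (v + v'); ring.
  - by move=> c _ [u [v ->]]; exists (c * u), (c * v); ring.
by rewrite !inE => /orP[] /eqP->; [exists 1, 0 | exists 0, 1]; ring.
Qed.

(** * Four generators with AD = BC *)

Section FourGenerators.

Variables A B C D : R.

Definition monomial_of_degree (n : nat) : R -> Prop := fun p =>
  exists j l k z, (j + l + k + z)%N = n /\
                  p = A ^+ j * B ^+ l * C ^+ k * D ^+ z.

Lemma gen4_monomial p : p \in [:: A; B; C; D] -> monomial_of_degree 1 p.
Proof.
rewrite !inE => /or4P[] /eqP->;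
  [exists 1, 0, 0, 0 | exists 0, 1, 0, 0 | exists 0, 0, 1, 0 | exists 0, 0, 0, 1];
  by split=> //; ring.
Qed.

Lemma monomialM m n p q :
  monomial_of_degree m p -> monomial_of_degree n q ->
  monomial_of_degree (m + n) (p * q).
Proof.
move=> [j [l [k [z [<- ->]]]]] [j' [l' [k' [z' [<- ->]]]]].
exists (j + j')%N, (l + l')%N, (k + k')%N, (z + z')%N; split; first by lia.
by rewrite !exprD; ring.
Qed.

Lemma exp_gen4_le n :
  ideal_le (ideal_exp (ideal_gen [:: A; B; C; D]) n)
           (ideal_span (monomial_of_degree n)).
Proof.
elim: n => [p _|n IHn p /(mul_mono (fun=> id) IHn)].
  have [_ _ M] := span_ideal (monomial_of_degree 0).
  rewrite -[p]mulr1; apply/M/mem_span.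
  by exists 0, 0, 0, 0; split=> //; ring.
apply: mul_span_le p => [|s t /gen4_monomial s1 tn]; first exact: span_ideal.
by apply: mem_span; rewrite -[n.+1]add1n; apply: monomialM.
Qed.

Lemma mem_exp_gen4 j l k z :
  ideal_exp (ideal_gen [:: A; B; C; D]) (j + l + k + z)
            (A ^+ j * B ^+ l * C ^+ k * D ^+ z).
Proof.
set I := ideal_gen _.
have addn_exp m n p q :
    ideal_exp I n p -> I q -> ideal_exp I (m + n) (q ^+ m * p).
  move=> Ip Iq; elim: m => [|m IHm]; first by rewrite mul1r.
  by rewrite addSn exprS -mulrA; apply: mem_mul.
have gen p : p \in [:: A; B; C; D] -> I p by apply: mem_span.
rewrite -!mulrA -!addnA.
do 3!(apply: (addn_exp); last by apply: (gen); rewrite !inE eqxx ?orbT).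
by apply: mem_exp; apply: gen; rewrite !inE eqxx ?orbT.
Qed.

(** The two inclusions are not symmetric: J I^a <= I^(a+1) is just J <= I.
    For the other, a product of a+1 generators which involves A or D lies in
    J I^a by construction.  A mixed product of B and C is rewritten with
    BC = AD, and the last two hypotheses cover the two pure powers. *)
Lemma reduction_gen4 a :
  B * C = A * D -> B ^+ a.+1 = A * C ^+ a -> C ^+ a.+1 = B ^+ a * D ->
  reduction_eq (ideal_gen [:: A; D]) (ideal_gen [:: A; B; C; D]) a.
Proof.
move=> BC Ba Ca; set J := ideal_gen [:: A; D]; set I := ideal_gen _.
have JI : ideal_le J I.
  by apply: gen_mono => p; rewrite !inE => /orP[] ->; rewrite ?orbT.
move=> p; split; last exact: mul_mono.
move/exp_gen4_le; apply: span_le p; first exact: mul_ideal.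
have JA : J A by apply: mem_span; rewrite !inE eqxx.
have JD : J D by apply: mem_span; rewrite !inE eqxx orbT.
have toJ j l k z q r : (j + l + k + z)%N = a -> J q ->
    r = q * (A ^+ j * B ^+ l * C ^+ k * D ^+ z) ->
    ideal_mul J (ideal_exp I a) r.
  by move=> <- Jq ->; apply: mem_mul => //; apply: mem_exp_gen4.
move=> _ [[|j] [l [k [z [deg ->]]]]]; last first.
  by apply: (toJ j l k z A) => //; [lia | rewrite ?exprS; ring].
case: z deg => [|z] deg; last first.
  by apply: (toJ 0 l k z D) => //; [lia | rewrite ?exprS; ring].
case: l deg => [|l] deg.
  have -> : k = a.+1 by lia.
  by apply: (toJ 0 a 0 0 D) => //; [lia | rewrite Ca; ring].
case: k deg => [|k] deg.
  have -> : l = a by lia.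
  by apply: (toJ 0 0 a 0 A) => //; [lia | rewrite Ba; ring].
apply: (toJ 0 l k 1 A) => //; first by lia.
transitivity (B * C * (B ^+ l * C ^+ k)); first by rewrite !exprS; ring.
by rewrite BC ?exprS; ring.
Qed.

Lemma mul_gen2_exp_gen4_le a (H : R -> Prop) :
  is_ideal H ->
  (forall j l k z, (j + l + k + z)%N = a.+1 -> (0 < j + z)%N ->
     H (A ^+ j * B ^+ l * C ^+ k * D ^+ z)) ->
  ideal_le (ideal_mul (ideal_gen [:: A; D])
              (ideal_exp (ideal_gen [:: A; B; C; D]) a)) H.
Proof.
move=> idH Hgen p /(mul_mono (fun=> id) (@exp_gen4_le a)).
apply: mul_span_le p => // s _ Js [j [l [k [z [deg ->]]]]].
move: Js; rewrite !inE => /orP[] /eqP->; rewrite !mulrA.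
  by rewrite -exprS; apply: Hgen; lia.
have -> : D * A ^+ j * B ^+ l * C ^+ k * D ^+ z =
          A ^+ j * B ^+ l * C ^+ k * D ^+ z.+1 by rewrite exprS; ring.
by apply: Hgen; lia.
Qed.

End FourGenerators.

End IdealTheory.

(** * Polynomials with restricted support *)

Section Support.

Set Implicit Arguments.
Unset Strict Implicit.

Variables (R : comNzRingType) (n : nat).
Implicit Types (p q u : {mpoly R[n]}) (m : 'X_{1..n}) (E : pred 'X_{1..n}).

Definition supported E : {mpoly R[n]} -> Prop :=
  fun p => forall m, m \in msupp p -> E m.

Lemma supported_coef0 E p m : supported E p -> ~~ E m -> p@_m = 0.
Proof. by move=> Ep; apply: contraNeq; rewrite -mcoeff_msupp; apply: Ep. Qed.

Lemma supportedX E m : E m -> supported E 'X_[m].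
Proof. by move=> Em m'; rewrite msuppX inE => /eqP->. Qed.

Lemma supportedM E E' (F : pred 'X_{1..n}) p q :
  (forall m m', E m -> E' m' -> F (m + m')%MM) ->
  supported E p -> supported E' q -> supported F (p * q).
Proof.
move=> EF Ep Eq m /msuppM_le /allpairsP[[m1 m2] /= [/Ep E1 /Eq E2 ->]].
exact: EF.
Qed.

Lemma supported_ideal E :
  (forall m m', E m' -> E (m + m')%MM) -> is_ideal (supported E).
Proof.
move=> Eup; split=> [m|p q Ep Eq m|c p Ep].
- by rewrite msupp0.
- by move/msuppD_le; rewrite mem_cat => /orP[/Ep|/Eq].
- by apply: (@supportedM xpredT E) => // m m' _; apply: Eup.
Qed.

Lemma supported_le E (H : {mpoly R[n]} -> Prop) :
  is_ideal H -> (forall m, E m -> H 'X_[m]) -> ideal_le (supported E) H.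
Proof.
case=> H0 HD HM HE p Ep; rewrite [p]mpolyE big_seq.
elim/big_ind: _ => // m /Ep Em; rewrite -mul_mpolyC.
exact/HM/HE.
Qed.

Definition order_ge k := supported (fun m => k <= mdeg m)%N.

Lemma order_ge_ideal k : is_ideal (order_ge k).
Proof.
by apply: supported_ideal => m m' lek; rewrite mdegD (leq_trans lek) ?leq_addl.
Qed.

Lemma order_geM k l p q : order_ge k p -> order_ge l q -> order_ge (k + l) (p * q).
Proof. by apply: supportedM => m m'; rewrite mdegD; apply: leq_add. Qed.

Lemma order_ge_sub_const p : order_ge 1 (p - (p@_0)%:MP).
Proof.
move=> m; rewrite lt0n mdeg_eq0; apply: contraTneq => ->.
by rewrite mcoeff_msupp mcoeffB mcoeffC eqxx mulr1 subrr eqxx.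
Qed.

(** In the lowest degree that occurs in u, only the constant term of p
    contributes. *)
Lemma mcoeffM_order p u m :
  order_ge (mdeg m) u -> (p * u)@_m = p@_0 * u@_m.
Proof.
move=> Ou; rewrite -{1}[p](subrK (p@_0)%:MP) mulrDl mcoeffD mcoeffCM.
rewrite (supported_coef0 (order_geM (@order_ge_sub_const p) Ou)) ?add0r //.
by rewrite add1n -ltnNge.
Qed.

Lemma mcoeffMX_eq0 p e m : ~~ (e <= m)%MM -> (p * 'X_[e])@_m = 0.
Proof.
apply: supported_coef0.
apply: (@supportedM xpredT (fun m' => e <= m')%MM) => // [m1 m2 _ le2|].
  exact: lepm_trans le2 (lem_addl _ _).
exact/supportedX/lepm_refl.
Qed.

End Support.

(** * Reductions contained in (x^d, y^d) *)

Section TwoVariables.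

Set Implicit Arguments.
Unset Strict Implicit.

Variable K : fieldType.

Local Notation x := ('X_ord0 : {mpoly K[2]}).
Local Notation y := ('X_ord_max : {mpoly K[2]}).

Definition bim (i j : nat) : 'X_{1..2} := (U_(ord0) *+ i + U_(ord_max) *+ j)%MM.

Lemma bim_ord0 i j : bim i j ord0 = i.
Proof. by rewrite mnmDE !mulmnE !mnm1E /= mul1n mul0n addn0. Qed.

Lemma bim_ord_max i j : bim i j ord_max = j.
Proof. by rewrite mnmDE !mulmnE !mnm1E /= mul1n mul0n. Qed.

Lemma ord2P (P : 'I_2 -> Prop) : P ord0 -> P ord_max -> forall i, P i.
Proof.
move=> P0 P1 [[|[|//]] lti]; first by rewrite (_ : Ordinal _ = ord0) //; apply: val_inj.
by rewrite (_ : Ordinal _ = ord_max) //; apply: val_inj.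
Qed.

Lemma bim_eta (m : 'X_{1..2}) : m = bim (m ord0) (m ord_max).
Proof. by apply/mnmP; apply: ord2P; rewrite ?bim_ord0 ?bim_ord_max. Qed.

Lemma bim_le i j i' j' : (bim i j <= bim i' j')%MM = (i <= i')%N && (j <= j')%N.
Proof.
apply/mnm_lepP/andP => [le_ij | [lei lej]].
  by have := (le_ij ord0, le_ij ord_max); rewrite !bim_ord0 !bim_ord_max => -[].
by apply: ord2P; rewrite ?bim_ord0 ?bim_ord_max.
Qed.

Lemma bimD i j i' j' : (bim i j + bim i' j')%MM = bim (i + i') (j + j').
Proof. by apply/mnmP; apply: ord2P; rewrite mnmDE ?bim_ord0 ?bim_ord_max. Qed.

Lemma mdeg_bim i j : mdeg (bim i j) = (i + j)%N.
Proof. by rewrite mdegD !mdegMn !mdeg1 !mul1n. Qed.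

Lemma mpolyX_bim i j : 'X_[bim i j] = x ^+ i * y ^+ j.
Proof. by rewrite mpolyXD !mpolyXn. Qed.

Section PowerIdeal.

Variable d : nat.
Hypothesis d_gt0 : (0 < d)%N.

Section Diagonal.

Variables s t : K.

(** The part of degree n d of u, restricted to the monomials in x^d and y^d and
    evaluated at x^d = t, y^d = s.  It stands in for a substitution
    homomorphism into K, which would require d-th roots of t and s. *)
Definition diag (n : nat) (u : {mpoly K[2]}) : K :=
  \sum_(k < n.+1) t ^+ k * s ^+ (n - k) * u@_(bim (k * d) ((n - k) * d)).

Lemma diagD n u v : diag n (u + v) = diag n u + diag n v.
Proof. by rewrite -big_split; apply: eq_bigr => k _; rewrite mcoeffD mulrDr. Qed.

Lemma diag_sum n r (F : 'I_r -> {mpoly K[2]}) :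
  diag n (\sum_(i < r) F i) = \sum_(i < r) diag n (F i).
Proof.
apply: (big_morph (diag n) (diagD n)).
by rewrite /diag big1 // => k _; rewrite mcoeff0 mulr0.
Qed.

Lemma diag_xpow n : diag n ((x ^+ d) ^+ n) = t ^+ n.
Proof.
have -> : (x ^+ d) ^+ n = 'X_[bim (n * d) 0].
  by rewrite mpolyX_bim expr0 mulr1 -exprM mulnC.
rewrite /diag big_ord_recr big1 /= => [|k _]; last first.
  rewrite mcoeffX (_ : (_ == _) = false) ?mulr0 //; apply/negP => /eqP eqb.
  have := congr1 (fun m : 'X_{1..2} => m ord0) eqb; rewrite !bim_ord0 => /eqP.
  by rewrite eqn_pmul2r // => /eqP eqnk; have := ltn_ord k; rewrite -eqnk ltnn.
by rewrite subnn mul0n mcoeffX eqxx !mulr1 add0r.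
Qed.

Lemma diag_ypow n : diag n ((y ^+ d) ^+ n) = s ^+ n.
Proof.
have -> : (y ^+ d) ^+ n = 'X_[bim 0 (n * d)].
  by rewrite mpolyX_bim expr0 mul1r -exprM mulnC.
rewrite /diag big_ord_recl big1 /= => [|k _]; last first.
  rewrite mcoeffX (_ : (_ == _) = false) ?mulr0 //; apply/negP => /eqP eqb.
  have := congr1 (fun m : 'X_{1..2} => m ord0) eqb; rewrite !bim_ord0 => /esym/eqP.
  by rewrite muln_eq0 /= -leqn0 leqNgt d_gt0.
by rewrite subn0 mul0n mcoeffX eqxx mulr1 mul1r addr0.
Qed.

(** On u of order at least n d, multiplication by al x^d + be y^d acts in the
    lowest degree through the constant terms of al and be, and multiplication
    by x^d or y^d shifts the sum by one index. *)
Lemma diagM n al be u : order_ge (n * d) u ->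
  diag n.+1 ((al * x ^+ d + be * y ^+ d) * u) =
  (t * al@_0 + s * be@_0) * diag n u.
Proof.
move=> Ou.
have xX : x ^+ d = 'X_[bim d 0] by rewrite mpolyX_bim expr0 mulr1.
have yX : y ^+ d = 'X_[bim 0 d] by rewrite mpolyX_bim expr0 mul1r.
have coefM c (k : 'I_n.+1) :
    (c * u)@_(bim (k * d) ((n - k) * d)) = c@_0 * u@_(bim (k * d) ((n - k) * d)).
  apply: mcoeffM_order.
  by rewrite mdeg_bim -mulnDl subnKC // -ltnS ltn_ord.
rewrite mulrDl diagD [RHS]mulrDl; congr (_ + _).
  rewrite {1}/diag big_ord_recl /= xX (mulrAC al) mcoeffMX_eq0; last first.
    by rewrite bim_le mul0n leqNgt d_gt0.
  rewrite mulr0 add0r mulr_sumr; apply: eq_bigr => k _.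
  rewrite /bump /= add1n subSS mulSn -[in bim _ _](add0n ((n - k) * d)%N) -bimD.
  by rewrite mcoeffMX coefM exprS; ring.
rewrite {1}/diag big_ord_recr /= yX (mulrAC be) mcoeffMX_eq0; last first.
  by rewrite bim_le subnn mul0n [(d <= 0)%N]leqNgt d_gt0 andbF.
rewrite mulr0 addr0 mulr_sumr; apply: eq_bigr => k _ /=.
rewrite subSn; last by rewrite -ltnS ltn_ord.
rewrite mulSn -[in bim _ _](add0n (k * d)%N) -bimD.
by rewrite mcoeffMX coefM exprS; ring.
Qed.

End Diagonal.

Let J := ideal_gen [:: x ^+ d; y ^+ d].

Variable I : {mpoly K[2]} -> Prop.
Hypothesis JI : ideal_le J I.
Hypothesis I_order : ideal_le I (order_ge d).

Lemma exp_order n : ideal_le (ideal_exp I n) (order_ge (n * d)).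
Proof.
elim: n => [p _ m _ //|n IHn].
apply: mul_le => [|p q /I_order Ip /IHn Iq]; first exact: order_ge_ideal.
exact: order_geM.
Qed.

Lemma gen_x : J (x ^+ d).
Proof. by apply: mem_span; rewrite !inE eqxx. Qed.

Lemma gen_y : J (y ^+ d).
Proof. by apply: mem_span; rewrite !inE eqxx orbT. Qed.

(** A monomial of degree at least 2 n d has one exponent at least n d, and is
    then a multiple of (x^d)^n or (y^d)^n. *)
Lemma order_le_exp n : ideal_le (order_ge (n * d + n * d)) (ideal_exp I n).
Proof.
have [_ _ M] := exp_ideal I n.
apply: supported_le => [|m]; first exact: exp_ideal.
rewrite [m]bim_eta mdeg_bim mpolyX_bim; move: (m _) (m _) => j i deg_ij.
have [lei | lti] := leqP (n * d) i.
  rewrite -(subnK lei) exprD mulrAC; apply: M.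
  by rewrite mulnC exprM; apply/mem_exp/JI/gen_x.
have lej : (n * d <= j)%N by lia.
rewrite -(subnK lej) exprD mulrA; apply: M.
by rewrite mulnC exprM; apply/mem_exp/JI/gen_y.
Qed.

Section Reduction.

Variables (L : {mpoly K[2]} -> Prop) (r : nat).
Hypothesis idL : is_ideal L.
Hypothesis LJ : ideal_le L J.
Hypothesis Lr : reduction_eq L I r.

(** No nonzero linear functional on K^2 vanishes on the pairs (al(0), be(0))
    coming from L: otherwise [diag s t r.+1] would vanish on L I^r, which
    contains the (r+1)-st powers of x^d and y^d. *)
Lemma functional_neq0 s t : (s != 0) || (t != 0) ->
  exists al be, L (al * x ^+ d + be * y ^+ d) /\ t * al@_0 + s * be@_0 != 0.
Proof.
move=> st_neq0.
have [p Ip diag_p] : exists2 p, ideal_exp I r.+1 p & diag s t r.+1 p != 0.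
  case/orP: st_neq0 => [s0|t0].
    exists ((y ^+ d) ^+ r.+1); first exact/mem_exp/JI/gen_y.
    by rewrite diag_ypow expf_neq0.
  exists ((x ^+ d) ^+ r.+1); first exact/mem_exp/JI/gen_x.
  by rewrite diag_xpow expf_neq0.
have [N [c [w [wLI def_p]]]] : ideal_mul L (ideal_exp I r) p by apply/Lr.
have [i diag_i] : exists i, diag s t r.+1 (c i * w i) != 0.
  apply/existsP; apply: contraNT diag_p => /existsPn all0.
  rewrite def_p diag_sum big1 // => i _; apply/eqP.
  by have := all0 i; rewrite negbK.
have [l [u [Ll Iu def_w]]] := wLI i.
have Lcl : L (c i * l) by case: idL => _ _; apply.
have [al [be def_cl]] := gen2P (LJ Lcl).
exists al, be; rewrite -def_cl; split=> //.
move: diag_i; rewrite def_w mulrA def_cl diagM; last exact: exp_order Iu.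
by rewrite mulf_eq0 negb_or => /andP[].
Qed.

(** J <= L + m J, since the lowest parts of elements of L exhaust those of J. *)
Lemma gens_mod_maximal g : J g ->
  exists q al be, [/\ L q, order_ge 1 al, order_ge 1 be &
                      g = q + (al * x ^+ d + be * y ^+ d)].
Proof.
have [_ LD LM] := idL.
(* A first element with b1(0) <> 0, then one on which the functional that
   kills (a1(0), b1(0)) is nonzero: their constant terms form a basis. *)
have [a1 [b1 [L1 /=]]] : exists al be,
    L (al * x ^+ d + be * y ^+ d) /\ 0 * al@_0 + 1 * be@_0 != 0.
  by apply: functional_neq0; rewrite oner_eq0.
rewrite mul0r add0r mul1r => b1_neq0.
have [a2 [b2 [L2 det]]] : exists al be, L (al * x ^+ d + be * y ^+ d) /\
    b1@_0 * al@_0 + - a1@_0 * be@_0 != 0.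
  by apply: functional_neq0; rewrite b1_neq0 orbT.
set D := b1@_0 * a2@_0 + _ in det.
case/gen2P=> u [v ->].
(* Cramer's rule for the constant terms of (a1, b1) and (a2, b2). *)
pose c1 := (v@_0 * a2@_0 - u@_0 * b2@_0) / D.
pose c2 := (u@_0 * b1@_0 - v@_0 * a1@_0) / D.
exists (c1%:MP * (a1 * x ^+ d + b1 * y ^+ d)
        + c2%:MP * (a2 * x ^+ d + b2 * y ^+ d)).
exists (u - (c1%:MP * a1 + c2%:MP * a2)), (v - (c1%:MP * b1 + c2%:MP * b2)).
have order1 w : w@_0 = 0 -> order_ge 1 w.
  by move=> w0; have := order_ge_sub_const (p := w); rewrite w0 mpolyC0 subr0.
split.
- by apply: (LD); apply: (LM).
- by apply: order1; rewrite mcoeffB mcoeffD !mcoeffCM /c1 /c2 /D; field.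
- by apply: order1; rewrite mcoeffB mcoeffD !mcoeffCM /c1 /c2 /D; field.
- by ring.
Qed.

(** J <= L + m^k J, by substituting J <= L + m J into itself. *)
Lemma nakayama_iterate k g : J g ->
  exists q al be, [/\ L q, order_ge k al, order_ge k be &
                      g = q + (al * x ^+ d + be * y ^+ d)].
Proof.
have [L0 LD LM] := idL.
elim: k => [|k IHk] in g *.
  by case/gen2P=> u [v ->]; exists 0, u, v; split=> //; rewrite add0r.
case/IHk=> q [al [be [Lq Oal Obe ->]]].
have [q1 [a1 [b1 [Lq1 Oa1 Ob1 def_x]]]] := gens_mod_maximal gen_x.
have [q2 [a2 [b2 [Lq2 Oa2 Ob2 def_y]]]] := gens_mod_maximal gen_y.
have [_ OD _] := order_ge_ideal K 2 k.+1.
exists (q + (al * q1 + be * q2)).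
exists (al * a1 + be * a2), (al * b1 + be * b2); split.
- by apply: (LD) => //; apply: (LD); apply: (LM).
- by apply: (OD); rewrite -[k.+1]addn1; apply: order_geM.
- by apply: (OD); rewrite -[k.+1]addn1; apply: order_geM.
- by rewrite {1}def_y {1}def_x; ring.
Qed.

(** I^(r+1) = L I^r is contained in L, so L contains a power of m and the
    remainders in L + m^k J are absorbed for k large. *)
Lemma power_ideal_le_reduction : ideal_le J L.
Proof.
have [_ LD LM] := idL.
have exp_le_L : ideal_le (ideal_exp I r.+1) L.
  move=> p /Lr; apply: mul_le p => // p q Lp _.
  by rewrite mulrC; apply: (LM).
move=> g /(nakayama_iterate (r.+1 * d + r.+1 * d))[q [al [be [Lq Oal Obe ->]]]].
have OL p c : order_ge (r.+1 * d + r.+1 * d) p -> L (p * c).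
  by move=> Op; rewrite mulrC; apply/LM/exp_le_L/order_le_exp.
by apply: (LD) => //; apply: (LD); apply: (OL).
Qed.

End Reduction.

Lemma power_ideal_minimal L : is_reduction L I -> ideal_le L J -> ideal_eq L J.
Proof.
case=> idL _ [r Lr] LJ p; split; first exact: LJ.
exact: power_ideal_le_reduction Lr p.
Qed.

End PowerIdeal.

(** * The reduction number *)

(** If a product A^j B^l C^k D^z of s+1 generators divides C^(s+1), the two are
    equal, having the same degree, and comparing exponents gives
    a (z - j) = j + l.  Either z = j, and then j = l = z = 0; or z > j, and then
    the a or more factors A and B leave no room for D among s+1 <= a factors,
    contrary to z > j.  So neither A nor D occurs. *)
Lemma pure_power_notin a s : (s < a)%N ->
  let A := x ^+ (2 * a + 1) in let B := x ^+ (a + 1) * y ^+ a in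
  let C := x ^+ a * y ^+ (a + 1) in let D := y ^+ (2 * a + 1) in
  ~ ideal_mul (ideal_gen [:: A; D])
      (ideal_exp (ideal_gen [:: A; B; C; D]) s) (C ^+ s.+1).
Proof.
move=> lt_sa A B C D.
have monoE j l k z : A ^+ j * B ^+ l * C ^+ k * D ^+ z =
    'X_[bim ((2 * a + 1) * j + (a + 1) * l + a * k)
            (a * l + (a + 1) * k + (2 * a + 1) * z)].
  by rewrite mpolyX_bim !exprMn -!exprM !exprD; ring.
(* The separating ideal: polynomials without any monomial dividing C^(s+1). *)
pose top := bim (a * s.+1) ((a + 1) * s.+1).
pose H := supported (R := K) (fun m => ~~ (m <= top)%MM).
have idH : is_ideal H.
  apply: supported_ideal => m m'; apply: contra => lem.
  exact: lepm_trans (lem_addl _ _) lem.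
move/(mul_gen2_exp_gen4_le idH) => HC.
have {HC} : H (C ^+ s.+1).
  apply: HC => j l k z deg jz; rewrite monoE.
  apply: supportedX; rewrite bim_le; apply/negP => /andP[le1 le2].
  (* The two inequalities are opposite, as the total degrees agree; what
     remains is a * (z - j) = j + l, while j + l + z <= a. *)
  have balance : (a * z = a * j + (j + l))%N by move: le1 le2; rewrite -deg; nia.
  have z_gt_j : (j < z)%N by rewrite ltnNge; apply/negP => lezj; nia.
  have : (a <= j + l)%N by nia.
  by lia.
have -> : C ^+ s.+1 = 'X_[top] by rewrite mpolyX_bim exprMn -!exprM.
by move=> /(_ top); rewrite msuppX inE eqxx lepm_refl => /(_ isT).
Qed.

End TwoVariables.

Theorem theorem3p4 (K : fieldType) (a : nat) (ha : (1 <= a)%N) :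
  let x : {mpoly K[2]} := 'X_ord0 in
  let y : {mpoly K[2]} := 'X_ord_max in
  let J := ideal_gen [:: x ^+ (2 * a + 1); y ^+ (2 * a + 1)] in
  let I := ideal_gen [:: x ^+ (2 * a + 1); x ^+ (a + 1) * y ^+ a;
                         x ^+ a * y ^+ (a + 1); y ^+ (2 * a + 1)] in
  is_minimal_reduction J I /\ is_reduction_number J I a.
Proof.
move=> x y J I.
have Ja : reduction_eq J I a.
  apply: reduction_gen4; rewrite ?exprMn -?exprM.
  - by rewrite mulrACA -!exprD; congr (x ^+ _ * y ^+ _); lia.
  - by rewrite mulrA -exprD; congr (x ^+ _ * y ^+ _); nia.
  - by rewrite -mulrA -exprD; congr (x ^+ _ * y ^+ _); nia.
have JI : ideal_le J I.
  by apply: gen_mono => p; rewrite !inE => /orP[] ->; rewrite ?orbT.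
have I_order : ideal_le I (order_ge (2 * a + 1)).
  apply: span_le => [|p]; first exact: order_ge_ideal.
  have deg i j : (i + j = 2 * a + 1)%N ->
      order_ge (2 * a + 1) (x ^+ i * y ^+ j).
    by move=> eq_ij; rewrite -mpolyX_bim; apply: supportedX; rewrite mdeg_bim eq_ij.
  rewrite !inE => /or4P[] /eqP->; try by apply: deg; lia.
    by rewrite -[x ^+ _]mulr1 -(expr0 y); apply: deg; lia.
  by rewrite -[y ^+ _]mul1r -(expr0 x); apply: deg; lia.
split; split=> //.
- by split=> //; [exact: span_ideal | exists a].
- by move=> L; apply: power_ideal_minimal => //; lia.
- move=> s Js; rewrite leqNgt; apply/negP => lt_sa.
  apply: (pure_power_notin (K := K) lt_sa); apply/Js/mem_exp/mem_span.
  by rewrite !inE eqxx !orbT.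
Qed.
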